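(* Assume that $J$ is Lasry--Lions monotone, i.e. $\langle J(\mu,\cdot)-J(\nu,\cdot),\mu-\nu\rangle\ge 0$ for all $\mu,\nu\in\mathcal P(\Omega)$, and that there is $L_m>0$ with $\|J(\mu,\cdot)-J(\nu,\cdot)\|_\infty\le L_mW_1(\mu,\nu)$ for all $\mu,\nu\in\mathcal P(\Omega)$. Let $(X_h)_{h>0}$ be a family of finite subsets of $\Omega$ and, for each $h>0$, let $Q_h:\Omega\to X_h$ be a measurable map with $\sup_{x\in\Omega}|Q_h(x)-x|\le h$. For each $h>0$ let $\mu_{0,h}\in\mathcal P(X_h)$ be an arbitrary full-support initialization, i.e. $\mu_{0,h}(\{x\})>0$ for all $x\in X_h$, and set $m_h:=\min_{x\in X_h}\mu_{0,h}(\{x\})$. Let $0<\lambda<\frac{1}{L_mD_\Omega}$ and, for each $h$, let $(\mu_{k,h},\nu_{k,h})_{k\ge0}$ be the KL Mirror-Prox iterates with stepsize $\lambda$ initialized from $\mu_{0,h}$. Choose positive integers $K_h\to\infty$ (as $h\to0$) such that $\frac{\log(1/m_h)}{K_h}\to0$ as $h\to 0$, and define $$\bar\nu_h:=\frac1{K_h}\sum_{k=0}^{K_h-1}\nu_{k,h}.$$ Then every weak limit point of $(\bar\nu_h)_{h>0}$ as $h\to 0$ solves the Minty variational inequality. More precisely, if $\bar\nu_{h_j}\Rightarrow\bar\nu$ weakly in $\mathcal P(\Omega)$ along some sequence $h_j\downarrow0$, then $$\langle J(\eta,\cdot),\bar\nu-\eta\rangle\le0\qquad\forall\,\eta\in\mathcal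 P(\Omega).$$
   Context: $\Omega\subset\mathbb R^d$ is a nonempty compact set, $D_\Omega:=\sup_{x,y\in\Omega}|x-y|$, and $\mathcal P(\Omega)$ is the set of Borel probability measures on $\Omega$. $J:\mathcal P(\Omega)\times\Omega\to\mathbb R$ is such that $J(\mu,\cdot)\in C(\Omega)$ for every $\mu\in\mathcal P(\Omega)$. For $f\in C(\Omega)$ and a finite signed measure $\xi$, $\langle f,\xi\rangle:=\int_\Omega f\,d\xi$. $W_1$ is the 1-Wasserstein distance on $\mathcal P(\Omega)$ for the Euclidean distance. $\Rightarrow$ denotes weak convergence of probability measures. For $X_h\subset\Omega$, $\mathcal P(X_h)$ is identified with the set of measures in $\mathcal P(\Omega)$ supported on $X_h$. KL Mirror-Prox iterates with stepsize $\lambda>0$ initialized from a probability measure $\mu_0$: for $k=0,1,2,\dots$, $$\nu_k(dx)=\frac{e^{-\lambda J(\mu_k,x)}\mu_k(dx)}{\int_\Omega e^{-\lambda J(\mu_k,z)}\mu_k(dz)},\qquad \mu_{k+1}(dx)=\frac{e^{-\lambda J(\nu_k,x)}\mu_k(dx)}{\int_\Omega e^{-\lambda J(\nu_k,z)}\mu_k(dz)}.$$ When $\mu_0=\mu_{0,h}$ is supported on the finite set $X_h$, all iterates are measures on $X_h$ (the integrals are finite sums). *)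

(* Defs.v *)
From HB Require Import structures.
From mathcomp Require Import all_boot all_order all_algebra.
From mathcomp Require Import all_classical all_reals all_analysis.
Import Order.TTheory GRing.Theory Num.Theory.
Import numFieldNormedType.Exports.

Set Implicit Arguments.
Unset Strict Implicit.
Unset Printing Implicit Defensive.

Local Open Scope classical_set_scope.
Local Open Scope ring_scope.

(* The library puts no sigma-algebra on row vectors: equip 'rV[R]_d with the
   Borel one.  The topology of 'rV[R]_d is given by the sup norm, hence is the
   usual one. *)
HB.instance Definition _ (R : realType) (d : nat) :=
  Measurable.copy 'rV[R]_d (g_sigma_algebraType (@open 'rV[R]_d)).

(* The norm `|x| of the library on 'rV[R]_d is the sup norm, hence the explicit
   Euclidean distance. *)
Definition eucl_dist (R : realType) (d : nat) (x y : 'rV[R]_d) : R :=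
  Num.sqrt (\sum_(i < d) (x ord0 i - y ord0 i) ^+ 2).

Definition diameter (R : realType) (d : nat) (Omega : set 'rV[R]_d) : R :=
  sup [set eucl_dist x y | x in Omega & y in Omega].

Definition supnorm (R : realType) (d : nat) (Omega : set 'rV[R]_d)
    (f : 'rV[R]_d -> R) : \bar R :=
  ereal_sup [set `|f x|%:E | x in Omega].

(* Borel probability measures on Omega, as Borel probability measures on R^d
   giving full mass to Omega. *)
Record prob_on (R : realType) (d : nat) (Omega : set 'rV[R]_d) := ProbOn {
  prob_on_measure :> probability 'rV[R]_d R ;
  prob_on_full : prob_on_measure Omega = 1%E }.

Section Defs.
Context {R : realType} {d : nat} {Omega : set 'rV[R]_d}.
Implicit Types (mu nu : prob_on Omega) (f : 'rV[R]_d -> R).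

(* < f , mu - nu > *)
Definition pairing f mu nu : R :=
  \int[mu]_(x in Omega) f x - \int[nu]_(x in Omega) f x.

Definition is_coupling mu nu
    (pi : probability ('rV[R]_d * 'rV[R]_d)%type R) : Prop :=
  forall A : set 'rV[R]_d, measurable A ->
    pi (A `*` setT) = mu A /\ pi (setT `*` A) = nu A.

Definition W1 mu nu : \bar R :=
  ereal_inf [set (\int[pi]_z (eucl_dist z.1 z.2)%:E)%E | pi in is_coupling mu nu].

(* C(Omega)-valued J; values of J mu outside of Omega are irrelevant. *)
Definition continuous_valued (J : prob_on Omega -> 'rV[R]_d -> R) : Prop :=
  forall mu, {within Omega, continuous (J mu)}.

Definition lasry_lions_monotone (J : prob_on Omega -> 'rV[R]_d -> R) : Prop :=
  forall mu nu, 0 <= pairing (fun x => J mu x - J nu x) mu nu.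

Definition W1_lipschitz (L : R) (J : prob_on Omega -> 'rV[R]_d -> R) : Prop :=
  forall mu nu,
    (supnorm Omega (fun x => (J mu x - J nu x)%R) <= L%:E * W1 mu nu)%E.

Definition minty_solution (J : prob_on Omega -> 'rV[R]_d -> R)
    (nubar : prob_on Omega) : Prop :=
  forall eta : prob_on Omega, pairing (J eta) nubar eta <= 0.

(* nu(dx) = e^(- lambda f(x)) mu(dx) / \int_Omega e^(- lambda f(z)) mu(dz) *)
Definition gibbs_update (lambda : R) f mu nu : Prop :=
  forall A : set 'rV[R]_d, measurable A ->
    nu A = ((\int[mu]_(x in A `&` Omega) expR (- lambda * f x)) /
            (\int[mu]_(z in Omega) expR (- lambda * f z)))%:E.

Definition mirror_prox (J : prob_on Omega -> 'rV[R]_d -> R) (lambda : R)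
    (mu0 : prob_on Omega) (mu nu : nat -> prob_on Omega) : Prop :=
  mu 0%N = mu0 /\
  forall k, gibbs_update lambda (J (mu k)) (mu k) (nu k) /\
            gibbs_update lambda (J (nu k)) (mu k) (mu k.+1).

Definition is_average (K : nat) (nu : nat -> prob_on Omega)
    (nubar : prob_on Omega) : Prop :=
  forall A : set 'rV[R]_d, measurable A ->
    (nubar A = (K%:R^-1)%:E * \sum_(0 <= k < K) nu k A)%E.

(* Test functions range over C(Omega), which is C_b(Omega) for compact Omega. *)
Definition weak_cvg (mus : nat -> prob_on Omega) (mu : prob_on Omega) : Prop :=
  forall f, {within Omega, continuous f} ->
    \int[mus n]_(x in Omega) f x @[n --> \oo] --> \int[mu]_(x in Omega) f x.

(* min_{x in X} mu {x}: for finite nonempty X the infimum is attained. *)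
Definition min_mass mu (X : set 'rV[R]_d) : R :=
  inf [set fine (mu [set x]) | x in X].

End Defs.

(* Main.v *)
Require Import Defs.
From HB Require Import structures.
From mathcomp Require Import all_boot all_order all_algebra.
From mathcomp Require Import all_classical all_reals all_analysis.
From mathcomp Require Import measurable_realfun ring lra.
Import Order.TTheory GRing.Theory Num.Theory.
Import numFieldNormedType.Exports.

Local Open Scope classical_set_scope.
Local Open Scope ring_scope.

(** The theorem is an energy estimate on the grid followed by a passage to the
    limit.

    Fix [h] and view all iterates as positive weights on the finite set [X h].
    For every probability weight [pi] on [X h], the second half-step gives
<<
  lambda <J nu_k, nu_k - pi> <= sum_i pi_i (ln mu_(k+1),i - ln mu_k,i).
>>
    Expanding the logarithms, the defect of this inequality is
    [KL(mu_(k+1) | nu_k) + KL(nu_k | mu_k)] minus the cross term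
    [lambda <J nu_k - J mu_k, nu_k - mu_(k+1)>].  The Lipschitz bound on [J] and
    [W1 <= diam * TV] make the cross term at most half the product of the l1
    distances [|nu_k - mu_k|] and [|nu_k - mu_(k+1)|], provided that
    [lambda * Lm * diam <= 1]; each KL divergence is at least a quarter of the
    squared l1 distance ([weak_pinsker]), so the cross term is absorbed
    ([mirror_prox_step]).  The constant 1/4, half of the sharp one, is just
    enough, and it follows from [ln t <= t - 1] applied to square roots.

    Summing over [k < K], the right-hand side telescopes to at most
    [ln (1 / m)], where [m] is the smallest initial mass
    ([mirror_prox_regret]).  Monotonicity of [J] replaces [J nu_k] by [J eta] on
    the left, which is then linear in [nu_k], so that averaging gives
<<
  <J eta_h, nubar_h - eta_h> <= ln (1 / m_h) / (lambda K_h)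
>>
    for every [eta_h] on the grid ([mirror_prox_minty_gap]).

    An arbitrary [eta] on [Omega] is compared with its image [eta_h] under the
    quantizer [Q h]: transporting each point to its image shows
    [W1 eta_h eta <= h], so replacing [J eta_h] by [J eta] costs [2 * Lm * h]
    ([quantization], [pairing_le_sup]).  As [h] tends to 0 the left-hand side
    tends to [<J eta, nubar - eta>]: the first integral by weak convergence,
    the second by dominated convergence since [Q h y] tends to [y]
    ([cvg_integral_quantized]).  The right-hand side tends to 0. *)

(** * Mirror-Prox on finitely many weights *)

Lemma sum1_inhabited {R : realType} {I : finType} (w : I -> R) :
  \sum_i w i = 1 -> exists i : I, true.
Proof.
move=> w1; have [i|I0] := pickP (@predT I); first by exists i.
by move: w1; rewrite big_pred0// => /esym/eqP; rewrite oner_eq0.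
Qed.

Section FiniteWeights.
Context {R : realType} {n : nat}.
Implicit Types p q r f g : 'I_n -> R.

(** One summand of the Pinsker inequality, with the Cauchy-Schwarz step already
    replaced by a weighted AM-GM inequality: with [s], [t] the square roots of
    [p], [q], the entropy term is at least [(s - t)^2 + p - q], because
    [ln (t / s) <= t / s - 1], while [|p - q| = |s - t| (s + t)]. *)
Lemma pinsker_pointwise (p q c : R) : 0 < p -> 0 < q -> 0 <= c ->
  c * `|p - q| + p - q <= p * (ln p - ln q) + c ^+ 2 / 2 * (p + q).
Proof.
move=> p0 q0 c0.
set s := Num.sqrt p; set t := Num.sqrt q.
have s0 : 0 < s by rewrite sqrtr_gt0.
have t0 : 0 < t by rewrite sqrtr_gt0.
have ps : p = s ^+ 2 by rewrite sqr_sqrtr// ltW.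
have qt : q = t ^+ 2 by rewrite sqr_sqrtr// ltW.
have lnE : ln p - ln q = - (ln (t / s) * 2).
  by rewrite ps qt !lnXn// ln_div// -mulrnBl -opprB mulNrn mulr_natr.
have ln_le : ln (t / s) <= t / s - 1.
  have := @le_ln1Dx R (t / s - 1).
  rewrite [1 + _]addrC subrK; apply.
  by rewrite ltrBrDl subrr divr_gt0.
have entropy : s ^+ 2 * 2 - s * t * 2 <= p * (ln p - ln q).
  rewrite lnE {1}ps mulrN mulrA lerNr.
  apply: (@le_trans _ _ (s ^+ 2 * (t / s - 1) * 2)).
    by rewrite ler_wpM2r// ler_wpM2l// sqr_ge0.
  by rewrite le_eqVlt; apply/orP; left; apply/eqP; field; rewrite gt_eqF.
have absE : `|p - q| = `|s - t| * (s + t).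
  by rewrite ps qt subr_sqr normrM [`|s + t|]ger0_norm// ltW// addr_gt0.
have sq : `|s - t| ^+ 2 = (s - t) ^+ 2 by rewrite real_normK// num_real.
(* With [u = |s - t|], the first square is the AM-GM step for [c u (s + t)];
   the second one turns [(s + t)^2] into [2 (p + q)]. *)
have aux1 := sqr_ge0 (`|s - t| - c / 2 * (s + t)).
have aux2 := sqr_ge0 (c * (s - t)).
rewrite -/s -/t in entropy *.
rewrite absE; move: entropy; move: (p * (ln p - ln q)) => e entropy.
rewrite ps qt; move: sq aux1; move: `|s - t| => u sq aux1.
nra.
Qed.

(** Summing [pinsker_pointwise] gives [c a <= KL + c^2] for the l1 distance
    [a] and every [c >= 0]; [c = a / 2] is the best choice.  The sharp constant
    is 1/2; 1/4 suffices for the stepsize condition of [mirror_prox_step]. *)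
Lemma weak_pinsker p q : (forall i, 0 < p i) -> (forall i, 0 < q i) ->
  \sum_i p i = 1 -> \sum_i q i = 1 ->
  (\sum_i `|p i - q i|) ^+ 2 / 4 <= \sum_i p i * (ln (p i) - ln (q i)).
Proof.
move=> p0 q0 p1 q1; set a := \sum_i _.
have a0 : 0 <= a by exact: sumr_ge0.
have a20 : 0 <= a / 2 by lra.
have : \sum_i (a / 2 * `|p i - q i| + p i - q i) <=
    \sum_i (p i * (ln (p i) - ln (q i)) + (a / 2) ^+ 2 / 2 * (p i + q i)).
  by apply: ler_sum => i _; exact: pinsker_pointwise.
rewrite !big_split/= -!mulr_sumr big_split/= sumrN p1 q1 -/a.
by move=> H; lra.
Qed.

Lemma ler_sum_sup_l1 (f w : 'I_n -> R) (c : R) : (forall i, `|f i| <= c) ->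
  \sum_i f i * w i <= c * \sum_i `|w i|.
Proof.
move=> fc; rewrite mulr_sumr; apply: ler_sum => i _.
by rewrite (le_trans (ler_norm _))// normrM ler_wpM2r.
Qed.

Lemma gibbs_mass_gt0 p (h : 'I_n -> R) : (forall i, 0 < p i) -> \sum_i p i = 1 ->
  0 < \sum_i p i * expR (h i).
Proof.
move=> p0 /sum1_inhabited[i0 _].
rewrite (bigD1 i0)//= ltr_pwDl//; first by rewrite mulr_gt0 ?expR_gt0.
by apply: sumr_ge0 => j _; rewrite mulr_ge0 ?expR_ge0// ltW.
Qed.

(** One iteration, with [p], [q], [r] the weights of [mu_k], [nu_k],
    [mu_(k+1)] and [g], [f] the values of [J mu_k], [J nu_k].  The logarithms
    of [q / p] and [r / p] are affine in [g] and [f], so the difference between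
    the two sides is exactly [KL(r | q) + KL(q | p)] minus
    [lambda * sum (f - g) (q - r)]; Young's inequality concludes. *)
Lemma mirror_prox_step (lambda c : R) p q r f g (pi : 'I_n -> R) :
  0 < lambda -> lambda * c <= 1 / 2 ->
  (forall i, 0 < p i) -> \sum_i p i = 1 ->
  (forall i, q i = p i * expR (- lambda * g i) /
                   \sum_j p j * expR (- lambda * g j)) ->
  (forall i, r i = p i * expR (- lambda * f i) /
                   \sum_j p j * expR (- lambda * f j)) ->
  (forall i, `|f i - g i| <= c * \sum_j `|q j - p j|) ->
  \sum_i pi i = 1 ->
  lambda * \sum_i f i * (q i - pi i) <= \sum_i pi i * (ln (r i) - ln (p i)).
Proof.
move=> lambda0 lambdac p0 p1 qE rE fg pi1.
set Zg := \sum_j _ in qE; set Zf := \sum_j _ in rE.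
have Zg0 : 0 < Zg by exact: gibbs_mass_gt0.
have Zf0 : 0 < Zf by exact: gibbs_mass_gt0.
have q0 i : 0 < q i by rewrite qE divr_gt0// mulr_gt0// expR_gt0.
have r0 i : 0 < r i by rewrite rE divr_gt0// mulr_gt0// expR_gt0.
have q1 : \sum_i q i = 1.
  by under eq_bigr do rewrite qE; rewrite -mulr_suml divff// gt_eqF.
have r1 : \sum_i r i = 1.
  by under eq_bigr do rewrite rE; rewrite -mulr_suml divff// gt_eqF.
have lnq i : ln (q i) = ln (p i) - lambda * g i - ln Zg.
  by rewrite qE ln_div ?posrE ?mulr_gt0 ?expR_gt0// lnM ?posrE ?expR_gt0// expRK mulNr.
have lnr i : ln (r i) = ln (p i) - lambda * f i - ln Zf.
  by rewrite rE ln_div ?posrE ?mulr_gt0 ?expR_gt0// lnM ?posrE ?expR_gt0// expRK mulNr.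
have affine (w h : 'I_n -> R) (k l : R) : \sum_i w i = 1 ->
    \sum_i w i * (l * h i + k) = l * \sum_i h i * w i + k.
  move=> w1; rewrite -[k in RHS]mul1r -w1 mulr_suml mulr_sumr -big_split/=.
  by apply: eq_bigr => i _; ring.
have KLrq := weak_pinsker _ _ r0 q0 r1 q1.
have KLqp := weak_pinsker _ _ q0 p0 q1 p1.
have {}KLrq : (\sum_i `|q i - r i|) ^+ 2 / 4 <=
    lambda * \sum_i (g i - f i) * r i + (ln Zg - ln Zf).
  under eq_bigr do rewrite distrC.
  rewrite -affine// (le_trans KLrq)// le_eqVlt; apply/orP; left; apply/eqP.
  by apply: eq_bigr => i _; rewrite lnr lnq; ring.
have {}KLqp : (\sum_i `|q i - p i|) ^+ 2 / 4 <=
    - lambda * \sum_i g i * q i - ln Zg.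
  rewrite -affine// (le_trans KLqp)// le_eqVlt; apply/orP; left; apply/eqP.
  by apply: eq_bigr => i _; rewrite lnq; ring.
have -> : \sum_i pi i * (ln (r i) - ln (p i)) =
    - lambda * \sum_i f i * pi i - ln Zf.
  by rewrite -affine//; apply: eq_bigr => i _; rewrite lnr; ring.
have cross := @ler_sum_sup_l1 _ (fun i => q i - r i) _ fg.
move: KLrq KLqp cross.
have -> : \sum_i (f i - g i) * (q i - r i) = \sum_i f i * q i
    - \sum_i g i * q i + \sum_i (g i - f i) * r i.
  by rewrite -sumrN -!big_split/=; apply: eq_bigr => i _; ring.
have -> : \sum_i f i * (q i - pi i) = \sum_i f i * q i - \sum_i f i * pi i.
  by rewrite -sumrN -big_split/=; apply: eq_bigr => i _; ring.
set a := \sum_i `|q i - p i|; set b := \sum_i `|q i - r i|.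
set F := \sum_i f i * q i; set G := \sum_i g i * q i.
set H := \sum_i _ * r i; set P := \sum_i f i * pi i.
move=> KLrq KLqp cross.
have a0 : 0 <= a by exact: sumr_ge0.
have b0 : 0 <= b by exact: sumr_ge0.
have cross1 : lambda * (F - G + H) <= lambda * (c * a * b) by rewrite ler_pM2l.
have cross2 : lambda * c * (a * b) <= 1 / 2 * (a * b).
  by rewrite ler_wpM2r// mulr_ge0.
have := sqr_ge0 (a - b).
lra.
Qed.

(** The bounds of [mirror_prox_step] telescope to the [pi]-average of
    [ln (p K) - ln (p 0)], where [p K <= 1] and [p 0 >= m]. *)
Lemma mirror_prox_regret (lambda c m : R) (p q f g : nat -> 'I_n -> R)
    (pi : 'I_n -> R) (K : nat) :
  0 < lambda -> lambda * c <= 1 / 2 -> 0 < m ->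
  (forall i, m <= p 0%N i) ->
  (forall k i, 0 < p k i) -> (forall k, \sum_i p k i = 1) ->
  (forall k i, q k i = p k i * expR (- lambda * g k i) /
                       \sum_j p k j * expR (- lambda * g k j)) ->
  (forall k i, p k.+1 i = p k i * expR (- lambda * f k i) /
                          \sum_j p k j * expR (- lambda * f k j)) ->
  (forall k i, `|f k i - g k i| <= c * \sum_j `|q k j - p k j|) ->
  (forall i, 0 <= pi i) -> \sum_i pi i = 1 ->
  lambda * \sum_(0 <= k < K) \sum_i f k i * (q k i - pi i) <= ln (1 / m).
Proof.
move=> lambda0 lambdac m0 mp p0 p1 qE pE fg pi0 pi1.
apply: (@le_trans _ _ (\sum_(0 <= k < K) \sum_i pi i * (ln (p k.+1 i) - ln (p k i)))).
  rewrite mulr_sumr; apply: ler_sum => k _.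
  exact: (mirror_prox_step _ _ _ _ _ _ _ _ lambda0 lambdac (p0 k) (p1 k) (qE k) (pE k)
    (fg k) pi1).
rewrite exchange_big/=.
have -> : ln (1 / m) = \sum_i pi i * ln (1 / m) by rewrite -mulr_suml pi1 [RHS]mul1r.
apply: ler_sum => i _; rewrite -mulr_sumr telescope_sumr// ler_wpM2l//.
rewrite ln_div ?posrE// ln1 lerB ?ler_ln ?posrE ?ln_le0//.
rewrite -(p1 K) (bigD1 i)//= lerDl sumr_ge0// => j _; exact: ltW.
Qed.

End FiniteWeights.

(** * Borel sets and finitely supported measures on row vectors *)

Section BorelRowVectors.
Context {R : realType} {d : nat}.
Local Notation T := 'rV[R]_d.

Lemma open_measurable_rV (A : set T) : open A -> measurable A.
Proof. by move=> oA; exact: sub_sigma_algebra. Qed.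

Lemma closed_measurable_rV (A : set T) : closed A -> measurable A.
Proof.
by move/closed_openC/open_measurable_rV/measurableC; rewrite setCK.
Qed.

Lemma hausdorff_rV : hausdorff_space T.
Proof. exact: norm_hausdorff. Qed.

Lemma measurable_set1_rV (x : T) : measurable [set x].
Proof.
apply: closed_measurable_rV.
by apply: accessible_closed_set1; apply: hausdorff_accessible; exact: hausdorff_rV.
Qed.

Lemma compact_measurable_rV (A : set T) : compact A -> measurable A.
Proof.
by move/(compact_closed hausdorff_rV); exact: closed_measurable_rV.
Qed.

Lemma within_continuous_measurable_rV (D : set T) (f : T -> R) :
  measurable D -> {within D, continuous f} -> measurable_fun D f.
Proof.
move=> mD /continuousP cf; apply: (measurability _ (RGenOpens.measurableE R)).
move=> _ [_ [a [b ->] <-]].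
have /open_subspaceP [V oV VD] : open (f @^-1` `]a, b[ : set (subspace D)).
  exact/cf/interval_open.
rewrite setIC -VD; apply: measurableI => //.
exact: open_measurable_rV.
Qed.

Lemma measurable_coord (j : 'I_d) : measurable_fun setT (fun x : T => x ord0 j).
Proof.
apply: within_continuous_measurable_rV => //.
by apply: continuous_subspaceT; exact: coord_continuous.
Qed.

(** Measurability is for the product of the Borel sigma-algebras, on which the
    transport cost of a coupling is integrated; it is reduced to coordinates. *)
Lemma measurable_eucl_dist :
  measurable_fun setT (fun z : T * T => eucl_dist z.1 z.2).
Proof.
have msqrt : measurable_fun setT (@Num.sqrt R).
  by apply: continuous_measurable_fun; exact: sqrt_continuous.
apply: (measurableT_comp msqrt).
apply: measurable_sum => i; apply: measurable_funX.
apply: measurable_funB.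
  exact: (measurableT_comp (measurable_coord i) measurable_fst).
exact: (measurableT_comp (measurable_coord i) measurable_snd).
Qed.

Lemma bounded_within_compact (D : set T) (f : T -> R) :
  compact D -> {within D, continuous f} ->
  exists M : R, forall x, D x -> `|f x| <= M.
Proof.
move=> cD cf; have := @compact_bounded R R^o _ (continuous_compact cf cD).
move=> [M [_ HM]]; exists (M + 1) => x Dx.
by apply: (HM (M + 1)) => /=; [rewrite ltrDl|exists x].
Qed.

(** The supremum defining the diameter is meaningful because compactness bounds
    every coordinate. *)
Lemma eucl_dist_le_diameter (D : set T) (x y : T) :
  compact D -> D x -> D y -> eucl_dist x y <= diameter D.
Proof.
move=> cD Dx Dy; apply: ub_le_sup; last by exists x => //; exists y.
have /boolp.choice[M HM] (i : 'I_d) : exists M : R, forall z, D z -> `|z ord0 i| <= M.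
  apply: bounded_within_compact => //.
  by apply: continuous_subspaceT; exact: coord_continuous.
exists (Num.sqrt (\sum_i (M i + M i) ^+ 2)) => _ [z Dz [w Dw <-]].
rewrite /eucl_dist ler_wsqrtr//; apply: ler_sum => i _.
rewrite -[leLHS]real_normK ?num_real//.
have : `|z ord0 i - w ord0 i| <= M i + M i.
  by rewrite (le_trans (ler_normB _ _))// lerD// HM.
by move=> H; rewrite lerXn2r// nnegrE (le_trans _ H).
Qed.

Lemma eucl_dist_xx (x : T) : eucl_dist x x = 0.
Proof.
by rewrite /eucl_dist big1 ?sqrtr0// => i _; rewrite subrr expr0n.
Qed.

Lemma eucl_dist_ge0 (x y : T) : 0 <= eucl_dist x y.
Proof. exact: sqrtr_ge0. Qed.

Lemma diameter_ge0 (D : set T) (x : T) : compact D -> D x -> 0 <= diameter D.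
Proof.
move=> cD Dx.
exact: le_trans (eucl_dist_ge0 _ _) (eucl_dist_le_diameter _ _ _ cD Dx Dx).
Qed.

Lemma coord_le_eucl_dist (x y : T) i : `|x ord0 i - y ord0 i| <= eucl_dist x y.
Proof.
rewrite -sqrtr_sqr ler_wsqrtr// (bigD1 i)//= lerDl.
by apply: sumr_ge0 => j _; exact: sqr_ge0.
Qed.

(** The topology of row vectors comes from the sup norm, which is dominated by
    the Euclidean distance. *)
Lemma cvg_eucl_dist (u : nat -> T) (x : T) :
  eucl_dist (u j) x @[j --> \oo] --> (0 : R) -> u j @[j --> \oo] --> x.
Proof.
move=> /cvgrPdist_lt H; apply/cvg_ballP => e e0; near=> j; split => // i k.
rewrite (ord1 i) /ball/= distrC (le_lt_trans (coord_le_eucl_dist _ _ _))//.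
rewrite (le_lt_trans (ler_norm _))// -normrN -sub0r.
by near: j; exact: H.
Unshelve. all: by end_near. Qed.

End BorelRowVectors.

Section FiniteSupport.
Context {R : realType} {d : nat}.
Local Notation T := 'rV[R]_d.
Context {n : nat} {x : 'I_n -> T}.
Hypothesis x_inj : injective x.

Lemma range_bigsetU : range x = \big[setU/set0]_(i <- enum 'I_n) [set x i].
Proof.
rewrite -bigcup_seq; apply/seteqP; split => [_ [i _ <-]|y [i /= _ ->]].
  by exists i => //=; rewrite mem_enum.
by exists i.
Qed.

Lemma measurable_range : measurable (range x).
Proof.
rewrite range_bigsetU; apply: bigsetU_measurable => i _.
exact: measurable_set1_rV.
Qed.

Lemma Rintegral_finite_support (mu : probability T R) (D : set T) (f : T -> R) :
  measurable D -> measurable_fun D f -> range x `<=` D -> mu (range x) = 1%E ->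
  (\int[mu]_(y in D) f y = \sum_i fine (mu [set x i]) * f (x i))%R.
Proof.
move=> mD mf xD mux.
have mX := measurable_range.
have muC : mu (D `\` range x) = 0.
  have muXC : mu (~` range x) = 0 by rewrite probability_setC// mux subee.
  by apply: subset_measure0 muXC => //; [exact: measurableD|exact: measurableC].
have mf' : measurable_fun D (EFin \o f) by exact/measurable_EFinP.
rewrite /Rintegral -(setDUK xD) integral_setU//; last 3 first.
- exact: measurableD.
- by rewrite setDUK.
- by apply/disj_setPS => y [? []].
rewrite [X in (_ + X)%E]null_set_integral ?adde0//; last 2 first.
- exact: measurableD.
- by apply: measurable_funS mf' => //; exact: subDsetl.
rewrite range_bigsetU integral_bigsetU_EFin//; last 4 first.
- by move=> i; exact: measurable_set1_rV.
- exact: enum_uniq.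
- by move=> i j _ _ [_ [-> /x_inj]].
- by rewrite -range_bigsetU; apply: measurable_funS mf'.
under eq_bigr => i _.
  rewrite (eq_integral (cst (f (x i))%:E)); last first.
    by move=> y; rewrite inE => ->.
  rewrite integral_cst; last exact: measurable_set1_rV.
  rewrite -[X in (_ * X)%E]fineK; last first.
    by apply: fin_num_measure; exact: measurable_set1_rV.
  rewrite -EFinM.
  over.
rewrite sumEFin /= big_enum/=; apply: eq_bigr => i _.
by rewrite mulrC.
Qed.

End FiniteSupport.

(** * Couplings and the Wasserstein distance *)

Section UnitMass.
Context {R : realType} {dU : measure_display} {U : measurableType dU}.
Variables (m : {measure set U -> \bar R}) (m1 : m setT = 1%E).

(** An alias of [m] on which the probability structure can be declared. *)
Definition unit_mass : set U -> \bar R := m.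

HB.instance Definition _ := isMeasure.Build _ _ _ unit_mass
  (measure0 m) (measure_ge0 m) (@measure_semi_sigma_additive _ _ _ m).

HB.instance Definition _ := Measure_isProbability.Build _ _ _ unit_mass m1.

Lemma probability_of_measure : exists P : probability U R, forall A, P A = m A.
Proof. by exists unit_mass. Qed.

End UnitMass.

Section Coupling.
Context {R : realType}.

Lemma discrete_probability {dU} {U : measurableType dU} {I : finType}
    (w : I -> R) (z : I -> U) :
  (forall i, 0 <= w i) -> \sum_i w i = 1 ->
  exists P : probability U R,
    (forall A, measurable A -> P A = (\sum_i w i * \1_A (z i))%:E) /\
    (forall f : U -> R, measurable_fun setT f -> (forall y, 0 <= f y) ->
       (\int[P]_y (f y)%:E = (\sum_i w i * f (z i))%:E)%E).
Proof.
move=> w0 w1.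
have [i0 _] := sum1_inhabited _ w1.
pose h k := nth i0 (index_enum I) k.
pose m k := mscale (NngNum (w0 (h k))) (\d_(z (h k))).
pose N := size (index_enum I).
have sumE (F : I -> \bar R) : (\sum_(k < N) F (h k) = \sum_i F i)%E.
  by rewrite [RHS](big_nth i0) big_mkord.
have mE A : msum m N A = (\sum_i w i * \1_A (z i))%:E.
  by rewrite /msum -sumEFin -sumE; apply: eq_bigr => k _; rewrite EFinM.
have [|P PE] := probability_of_measure (msum m N).
  by rewrite [LHS]mE; under eq_bigr do rewrite indicT mulr1; rewrite w1.
exists P; split => [A mA|f mf f0]; first by rewrite PE [LHS]mE.
have mf' : measurable_fun setT (EFin \o f) by exact/measurable_EFinP.
rewrite (eq_measure_integral (msum m N)); last by move=> A _ _; exact: PE.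
rewrite ge0_integral_measure_sum//; last by move=> y _; rewrite lee_fin.
rewrite -sumEFin -sumE; apply: eq_bigr => k _.
rewrite ge0_integral_mscale//; last by move=> y _; rewrite lee_fin.
by rewrite integral_dirac// diracT mul1e -EFinM.
Qed.

(** The common part [min p q] stays on the diagonal and the two excess parts,
    of equal total mass [t], are coupled independently.  Off the diagonal only
    the mass [t], half the l1 distance, is moved. *)
Lemma maximal_coupling {n : nat} (p q : 'I_n -> R) :
  (forall i, 0 <= p i) -> (forall i, 0 <= q i) ->
  \sum_i p i = 1 -> \sum_i q i = 1 ->
  exists w : 'I_n -> 'I_n -> R,
    [/\ forall i j, 0 <= w i j, forall i, \sum_j w i j = p i,
        forall j, \sum_i w i j = q j &
        \sum_i \sum_(j | j != i) w i j <= 1 / 2 * \sum_i `|p i - q i| ].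
Proof.
move=> p0 q0 p1 q1.
pose m i := Num.min (p i) (q i).
pose a i := p i - m i; pose b i := q i - m i.
have a0 i : 0 <= a i by rewrite subr_ge0 ge_min lexx.
have b0 i : 0 <= b i by rewrite subr_ge0 ge_min lexx orbT.
have m0 i : 0 <= m i by rewrite le_min p0 q0.
pose t := \sum_i a i.
have t0 : 0 <= t by exact: sumr_ge0.
have tb : \sum_i b i = t by rewrite /t /a /b !big_split/= p1 q1.
(* If [t = 0], the quotient by [t] is 0 by convention, and so is each [c i]. *)
have mulfK_total (c : 'I_n -> R) i :
    (forall i, 0 <= c i) -> \sum_i c i = t -> c i * t / t = c i.
  move=> c0 ct; have [t_eq0|t_neq0] := eqVneq t 0; last by rewrite mulfK.
  rewrite t_eq0 mulr0 mul0r; apply/esym/eqP.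
  move/eqP: ct; rewrite t_eq0 psumr_eq0//.
  by move=> /allP/(_ i); rewrite mem_index_enum; apply.
have diag (i : 'I_n) : \sum_j (j == i)%:R * m i = m i.
  by rewrite (bigD1 i)//= eqxx mul1r big1 ?addr0// => j /negPf->; rewrite mul0r.
have diag' (j : 'I_n) : \sum_i (j == i)%:R * m i = m j.
  rewrite (bigD1 j)//= eqxx mul1r big1 ?addr0// => i.
  by rewrite eq_sym => /negPf->; rewrite mul0r.
exists (fun i j => (j == i)%:R * m i + a i * b j / t); split.
- by move=> i j; apply: addr_ge0; [|apply: divr_ge0 => //]; exact: mulr_ge0.
- move=> i; rewrite big_split/= diag -mulr_suml -mulr_sumr tb mulfK_total//.
  by rewrite addrC subrK.
- move=> j; rewrite big_split/= diag' -mulr_suml -mulr_suml -/t [t * _]mulrC.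
  by rewrite mulfK_total// addrC subrK.
- apply: (@le_trans _ _ (\sum_i a i)).
    apply: ler_sum => i _; under eq_bigr => j /negPf-> do rewrite mul0r add0r.
    rewrite -{2}(mulfK_total a i)// -tb mulr_sumr mulr_suml.
    rewrite [leRHS](bigID (fun j => j != i))/= lerDl.
    by apply: sumr_ge0 => j _; rewrite tb divr_ge0// mulr_ge0.
  have : \sum_i `|p i - q i| = \sum_i a i + \sum_i b i.
    rewrite -big_split/=; apply: eq_bigr => i _; rewrite /a /b /m.
    rewrite minEle; case: ifPn => [pq|]; last rewrite -ltNge => /ltW pq.
      by rewrite ler0_norm ?subr_le0//; ring.
    by rewrite ger0_norm ?subr_ge0//; ring.
  by rewrite tb -/t => ->; lra.
Qed.

Section W1.
Context {d : nat} {Omega : set 'rV[R]_d}.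
Local Notation T := 'rV[R]_d.

Lemma W1_le_coupling_cost (mu nu : prob_on Omega) (pi : probability (T * T)%type R) :
  is_coupling mu nu pi ->
  (W1 mu nu <= \int[pi]_z (eucl_dist z.1 z.2)%:E)%E.
Proof. by move=> H; apply: ereal_inf_lbound; exists pi. Qed.

(** Under the maximal coupling, a mass of half the l1 distance travels at most
    the diameter.  The factor 1/2 is what makes the quarter of [weak_pinsker]
    sufficient up to [lambda * Lm * diameter Omega = 1]. *)
Lemma W1_le_total_variation {n : nat} (x : 'I_n -> T) (mu nu : prob_on Omega) :
  compact Omega -> injective x -> range x `<=` Omega ->
  mu (range x) = 1%E -> nu (range x) = 1%E ->
  (W1 mu nu <= (diameter Omega *
    (1 / 2 * \sum_i `|fine (nu [set x i]) - fine (mu [set x i])|))%:E)%E.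
Proof.
move=> cO xI xO mux nux.
have total (eta : prob_on Omega) A : measurable A -> eta (range x) = 1%E ->
    eta A = (\sum_i fine (eta [set x i]) * \1_A (x i))%:E.
  move=> mA etax.
  have mI : measurable_fun setT (\1_A : T -> R) by exact: measurable_indic.
  have := Rintegral_finite_support xI eta _ _ measurableT mI (fun _ _ => I) etax.
  by rewrite /Rintegral integral_indic// setIT => <-; rewrite fineK// fin_num_measure.
have p0 (eta : prob_on Omega) i : 0 <= fine (eta [set x i]) by rewrite fine_ge0.
have p1 (eta : prob_on Omega) : eta (range x) = 1%E ->
    \sum_i fine (eta [set x i]) = 1.
  move=> etax; apply: EFin_inj; rewrite -(@probability_setT _ _ _ eta).
  rewrite (total _ _ measurableT etax).
  by under [in RHS]eq_bigr do rewrite indicT mulr1.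
have [w [w0 wp wq wcost]] := maximal_coupling _ _ (p0 nu) (p0 mu) (p1 nu nux) (p1 mu mux).
have w1 : \sum_(k : 'I_n * 'I_n) w k.2 k.1 = 1.
  rewrite -(pair_big xpredT xpredT (fun i j => w j i))/=.
  by under eq_bigr do rewrite wq; exact: p1.
have [P [PE Pint]] := discrete_probability (fun k : 'I_n * 'I_n => w k.2 k.1)
  (fun k => (x k.1, x k.2)) (fun k => w0 _ _) w1.
apply: (le_trans (@W1_le_coupling_cost _ _ P _)).
  move=> A mA; split.
    rewrite PE ?(total _ _ mA mux); last exact: measurableX.
    congr EFin; rewrite -(pair_big xpredT xpredT (fun i j => w j i * \1_(A `*` setT) (x i, x j)))/=.
    apply: eq_bigr => i _; rewrite -wq mulr_suml; apply: eq_bigr => j _.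
    by rewrite /indic in_setX in_setT andbT.
  rewrite PE ?(total _ _ mA nux); last exact: measurableX.
  congr EFin; rewrite -(pair_big xpredT xpredT (fun i j => w j i * \1_(setT `*` A) (x i, x j)))/=.
  rewrite exchange_big/=.
  apply: eq_bigr => i _; rewrite -wp mulr_suml; apply: eq_bigr => j _.
  by rewrite /indic in_setX in_setT.
rewrite Pint//; [|exact: measurable_eucl_dist|by move=> z; exact: eucl_dist_ge0].
rewrite lee_fin -(pair_big xpredT xpredT (fun i j => w j i * eucl_dist (x i) (x j)))/=.
rewrite exchange_big/=.
have D0 : 0 <= diameter Omega.
  have [i0 _] := sum1_inhabited _ (p1 mu mux).
  by apply: (diameter_ge0 _ (x i0) cO); apply: xO; exists i0.
apply: (@le_trans _ _ (diameter Omega * \sum_i \sum_(j | j != i) w i j)); last exact: ler_wpM2l.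
rewrite mulr_sumr; apply: ler_sum => i _.
rewrite (bigD1 i)//= eucl_dist_xx mulr0 add0r mulr_sumr.
apply: ler_sum => j _; rewrite mulrC ler_wpM2r//.
by apply: eucl_dist_le_diameter => //; apply: xO; eexists.
Qed.

End W1.
End Coupling.

(** * Iterates on a finite subset of a compact set *)

Section CompactDomain.
Context {R : realType} {d : nat} {Omega : set 'rV[R]_d}.
Hypothesis Omega_compact : compact Omega.
Local Notation T := 'rV[R]_d.

Let mOmega : measurable Omega := compact_measurable_rV _ Omega_compact.

Lemma finite_set_enumeration (U : choiceType) (X : set U) : finite_set X ->
  exists n (x : 'I_n -> U), injective x /\ range x = X.
Proof.
move=> /finite_seqP[s ->].
exists (size (undup s)), (fun i => tnth (in_tuple (undup s)) i); split.
  by apply/tuple_uniqP; exact: undup_uniq.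
apply/seteqP; split => [_ [i _ <-]|y /=]; first by rewrite /= -mem_undup mem_tnth.
by rewrite -mem_undup => /(tnthP (in_tuple _))[i ->]; exists i.
Qed.

Lemma supnorm_le (f : T -> R) (c : R) y :
  (supnorm Omega f <= c%:E)%E -> Omega y -> `|f y| <= c.
Proof.
move=> H Oy; rewrite -lee_fin (le_trans _ H)//.
by apply: ereal_sup_ubound; exists y.
Qed.

Lemma cvg_within_seq (f : T -> R) (u : nat -> T) y :
  {within Omega, continuous f} -> (forall j, Omega (u j)) -> Omega y ->
  u j @[j --> \oo] --> y -> f (u j) @[j --> \oo] --> f y.
Proof.
move=> /subspace_continuousP cf Ou Oy uy.
apply: cvg_comp (cf y Oy) => A wA.
have wAu : \forall j \near \oo, Omega (u j) -> A (u j) := uy _ wA.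
rewrite /nbhs/=; apply: (filterS _ wAu) => j; apply; exact: Ou.
Qed.

Lemma integrable_within_compact (eta : probability T R) (f : T -> R) :
  {within Omega, continuous f} -> eta.-integrable Omega (EFin \o f).
Proof.
move=> cf; apply: measurable_bounded_integrable => //.
- by rewrite (le_lt_trans (probability_le1 _ _)) ?ltry.
- exact: within_continuous_measurable_rV.
have [M HM] := bounded_within_compact _ _ Omega_compact cf.
exists M; split; first exact: num_real.
by move=> r Mr y /= Oy; rewrite (le_trans (HM _ Oy))// ltW.
Qed.

(** The image of [eta] under [Q].  As [Q] is measurable on [Omega] only, it is
    first extended by the identity, which keeps the displacement at most [h]
    everywhere; the law of [(Q y, y)] is then a coupling of cost at most [h]. *)
Lemma quantization (eta : prob_on Omega) (X : set T) (Q : T -> T) (h : R) :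
  0 <= h -> measurable X -> X `<=` Omega -> measurable_fun Omega Q ->
  (forall y, Omega y -> X (Q y)) ->
  (forall y, Omega y -> eucl_dist (Q y) y <= h) ->
  exists eta' : prob_on Omega,
    [/\ eta' X = 1%E, (W1 eta' eta <= h%:E)%E &
     forall f, {within Omega, continuous f} ->
       \int[eta']_(y in Omega) f y = \int[eta]_(y in Omega) f (Q y)].
Proof.
move=> h0 mX XO mQ QX Qh.
pose phi y := if y \in Omega then Q y else y.
have phiO y : Omega y -> phi y = Q y by move=> Oy; rewrite /phi mem_set.
have phiN y : ~ Omega y -> phi y = y by move=> Oy; rewrite /phi memNset.
have mphi : measurable_fun setT phi.
  apply: measurable_fun_if => //.
  - apply: (measurable_fun_bool true); rewrite setTI.
    rewrite [X in measurable X](_ : _ = Omega)//.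
    by apply/seteqP; split => y /=; [exact: set_mem|exact: mem_set].
  - rewrite setTI [X in measurable_fun X](_ : _ = Omega)//.
    by apply/seteqP; split => y /=; [exact: set_mem|exact: mem_set].
have mphiI A : measurable A -> measurable (phi @^-1` A).
  by move=> mA; rewrite -[X in measurable X]setTI; exact: (mphi measurableT A mA).
have [P PE] := probability_of_measure (pushforward eta phi) (@probability_setT _ _ _ eta).
have full A : measurable A -> X `<=` A -> P A = 1%E.
  move=> mA XA; rewrite PE /=; apply/eqP; rewrite eq_le probability_le1/=; last first.
    exact: mphiI.
  rewrite -(prob_on_full eta) le_measure ?inE//.
  - exact: mphiI.
  - by move=> y Oy /=; apply: XA; rewrite phiO//; exact: QX.
exists (@ProbOn R d Omega P (full _ mOmega XO)); split => [| |f cf] /=.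
- exact: full.
- have mphi2 : measurable_fun setT (fun y => (phi y, y)).
    exact: measurable_fun_pair.
  have [C CE] := probability_of_measure (pushforward eta (fun y => (phi y, y)))
    (@probability_setT _ _ _ eta).
  apply: (le_trans (W1_le_coupling_cost _ _ C _)).
    move=> A mA; rewrite !CE /= PE /= /pushforward.
    by split; congr (eta _); apply/seteqP; split => y //= [].
  pose dist z : \bar R := (eucl_dist (z : T * T).1 z.2)%:E.
  have mdist : measurable_fun setT dist.
    by apply/measurable_EFinP; exact: measurable_eucl_dist.
  rewrite (eq_measure_integral (pushforward eta (fun y => (phi y, y)))); last first.
    by move=> A _ _; exact: CE.
  rewrite (ge0_integral_pushforward mphi2 _ measurableT mdist); last first.
    by move=> z _; rewrite lee_fin eucl_dist_ge0.
  rewrite preimage_setT; apply: (@le_trans _ _ (\int[eta]_y (cst h%:E y))%E).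
    apply: ge0_le_integral => //.
    - by move=> y _; rewrite lee_fin eucl_dist_ge0.
    - exact: measurableT_comp mdist mphi2.
    move=> y _ /=; rewrite /dist/= lee_fin.
    have [Oy|NOy] := pselect (Omega y); first by rewrite phiO//; exact: Qh.
    by rewrite phiN// eucl_dist_xx.
  by rewrite integral_cst// [X in (_ * X)%E]probability_setT mule1.
- rewrite Rintegral_mkcond [RHS]Rintegral_mkcond.
  have mf : measurable_fun setT (f \_ Omega).
    by apply/(measurable_restrictT f mOmega); exact: within_continuous_measurable_rV.
  have mf' : measurable_fun setT (EFin \o (f \_ Omega)) by exact/measurable_EFinP.
  have [M HM] := bounded_within_compact _ _ Omega_compact cf.
  rewrite /Rintegral (eq_measure_integral (pushforward eta phi)); last first.
    by move=> A _ _; exact: PE.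
  congr fine; rewrite (integral_pushforward mphi mf')//; last first.
    rewrite preimage_setT.
    apply: (measurable_bounded_integrable (f := (f \_ Omega) \o phi)) => //.
    - by rewrite (le_lt_trans (probability_le1 _ _)) ?ltry.
    - exact: measurableT_comp mf mphi.
    exists `|M|; split; first exact: num_real.
    move=> r Mr y _ /=; rewrite /patch; case: ifPn => [/set_mem Oy|_].
      by rewrite (le_trans (HM _ Oy))// (le_trans (ler_norm _))// ltW.
    by rewrite normr0 (le_trans _ (ltW Mr)).
  rewrite preimage_setT; apply: eq_integral => y _ /=; congr EFin.
  rewrite /patch; have [Oy|NOy] := pselect (Omega y).
    by rewrite phiO// !mem_set//; exact/XO/QX.
  by rewrite phiN// !memNset.
Qed.

Lemma integral_le_shift (mu : prob_on Omega) (f g : T -> R) (c : R) :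
  {within Omega, continuous f} -> {within Omega, continuous g} ->
  (forall y, Omega y -> f y <= g y + c) ->
  \int[mu]_(y in Omega) f y <= \int[mu]_(y in Omega) g y + c.
Proof.
move=> cf cg fg.
have cc : {within Omega, continuous (cst c : T -> R)}.
  exact/continuous_subspaceT/cst_continuous.
have -> : \int[mu]_(y in Omega) g y + c = \int[mu]_(y in Omega) (g y + c).
  rewrite RintegralD//; try exact: integrable_within_compact.
  by rewrite Rintegral_cst// [fine _](congr1 fine (prob_on_full mu)) mulr1.
apply: le_Rintegral => //; try exact: integrable_within_compact.
by apply: integrable_within_compact => y; apply: continuousD; [exact: cg|exact: cc].
Qed.

Lemma pairing_le_sup (mu nu : prob_on Omega) (f g : T -> R) (c : R) :
  {within Omega, continuous f} -> {within Omega, continuous g} ->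
  (forall y, Omega y -> `|f y - g y| <= c) ->
  pairing f mu nu <= pairing g mu nu + 2 * c.
Proof.
move=> cf cg fg; rewrite /pairing.
have : \int[mu]_(y in Omega) f y <= \int[mu]_(y in Omega) g y + c.
  apply: integral_le_shift => // y Oy.
  by have := fg y Oy; rewrite ler_norml => /andP[]; lra.
have : \int[nu]_(y in Omega) g y <= \int[nu]_(y in Omega) f y + c.
  apply: integral_le_shift => // y Oy.
  by have := fg y Oy; rewrite ler_norml => /andP[]; lra.
lra.
Qed.

(** Pointwise [Q j y] tends to [y], and [f] is continuous and bounded on
    [Omega]: dominated convergence applies. *)
Lemma cvg_integral_quantized (eta : prob_on Omega) (Q : nat -> T -> T) (h : nat -> R) f :
  {within Omega, continuous f} ->
  (forall j, measurable_fun Omega (Q j)) ->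
  (forall j y, Omega y -> Omega (Q j y)) ->
  (forall j y, Omega y -> eucl_dist (Q j y) y <= h j) ->
  h j @[j --> \oo] --> (0 : R) ->
  \int[eta]_(y in Omega) f (Q j y) @[j --> \oo] --> \int[eta]_(y in Omega) f y.
Proof.
move=> cf mQ QO Qh h0.
have mf := within_continuous_measurable_rV _ _ mOmega cf.
have [M HM] := bounded_within_compact _ _ Omega_compact cf.
have intf := integrable_within_compact eta _ cf.
have intM : (prob_on_measure eta).-integrable Omega (EFin \o cst M).
  by apply: integrable_within_compact; exact/continuous_subspaceT/cst_continuous.
have pointwise y : Omega y -> f (Q j y) @[j --> \oo] --> f y.
  move=> Oy; apply: cvg_within_seq => //; first by move=> j; exact: QO.
  apply: cvg_eucl_dist.
  apply: (squeeze_cvgr _ (cvg_cst 0) h0); near=> j.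
  by rewrite eucl_dist_ge0 Qh.
have mfQ j : measurable_fun Omega (EFin \o (f \o Q j)).
  apply/measurable_EFinP; apply: measurable_comp mf (mQ j) => //.
  by move=> _ [y Oy <-]; exact: QO.
have [||_ _ cvgQ] := @dominated_convergence _ _ _ eta Omega mOmega
  (fun j => EFin \o (f \o Q j)) (EFin \o f) (EFin \o cst M) mfQ
  ((measurable_EFinP _ _).2 mf) _ intM _.
- by apply: aeW => y Oy; apply: cvg_EFin; [exact: nearW|exact: pointwise].
- by apply: aeW => y j Oy; rewrite /= lee_fin HM//; exact: QO.
apply: fine_cvg; rewrite fineK; last exact: integrable_fin_num.
exact: cvgQ.
Unshelve. all: by end_near. Qed.

Section FiniteSupportOnOmega.
Context {n : nat} {x : 'I_n -> T}.
Hypothesis (x_inj : injective x) (x_Omega : range x `<=` Omega).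
Implicit Types mu nu : prob_on Omega.

Local Notation weight mu := (fun i => fine (prob_on_measure mu [set x i])).

Lemma Rintegral_weights mu f : {within Omega, continuous f} ->
  mu (range x) = 1%E ->
  \int[mu]_(y in Omega) f y = \sum_i weight mu i * f (x i).
Proof.
move=> cf mux; apply: Rintegral_finite_support => //.
exact: within_continuous_measurable_rV.
Qed.

Lemma weight_ge0 mu i : 0 <= weight mu i.
Proof. by rewrite fine_ge0. Qed.

Lemma sum_weights mu : mu (range x) = 1%E -> \sum_i weight mu i = 1.
Proof.
move=> mux.
have cst1 : {within Omega, continuous (fun _ : T => 1 : R)}.
  exact/continuous_subspaceT/cst_continuous.
have := Rintegral_weights _ _ cst1 mux.
rewrite Rintegral_cst// mul1r [fine _](congr1 fine (prob_on_full mu)) /= => ->.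
by apply: eq_bigr => i _; rewrite mulr1.
Qed.

Lemma weightK mu i : (weight mu i)%:E = mu [set x i].
Proof. by rewrite fineK//; apply: fin_num_measure; exact: measurable_set1_rV. Qed.

Lemma pairing_weights f mu nu : {within Omega, continuous f} ->
  mu (range x) = 1%E -> nu (range x) = 1%E ->
  pairing f mu nu = \sum_i f (x i) * (weight mu i - weight nu i).
Proof.
move=> cf mux nux; rewrite /pairing !Rintegral_weights// -sumrB.
by apply: eq_bigr => i _; rewrite mulrBr ![_ * f _]mulrC.
Qed.

Lemma continuous_exp_within (lambda : R) f : {within Omega, continuous f} ->
  {within Omega, continuous (fun y => expR (- lambda * f y))}.
Proof.
move=> cf y; apply: continuous_comp; last exact: continuous_expR.
by apply: continuousM; [exact: cvg_cst|exact: cf].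
Qed.

(** On a finite support the Gibbs update becomes the quotient of finite sums
    used in the first part, and it keeps the support. *)
Lemma gibbs_update_weights (lambda : R) f mu nu : {within Omega, continuous f} ->
  mu (range x) = 1%E -> (forall i, 0 < weight mu i) ->
  gibbs_update lambda f mu nu ->
  nu (range x) = 1%E /\
  forall i, weight nu i = weight mu i * expR (- lambda * f (x i)) /
                          \sum_j weight mu j * expR (- lambda * f (x j)).
Proof.
move=> cf mux mu0 nuE.
have cexp := continuous_exp_within lambda _ cf.
have Z0 : 0 < \sum_j weight mu j * expR (- lambda * f (x j)).
  by apply: gibbs_mass_gt0 => //; exact: sum_weights.
split=> [|i].
  rewrite nuE; last exact: measurable_range.
  rewrite (setIidl x_Omega) Rintegral_weights// (Rintegral_finite_support x_inj)//.
  - by rewrite divff// gt_eqF.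
  - exact: measurable_range.
  - apply: measurable_funS (within_continuous_measurable_rV _ _ mOmega cexp) => //.
have mx := measurable_set1_rV (x i).
rewrite nuE// Rintegral_weights//; congr (_ / _).
rewrite setIidl; last by move=> _ ->; apply: x_Omega; exists i.
rewrite (@eq_Rintegral _ _ _ _ _ (cst (expR (- lambda * f (x i))))).
  by rewrite Rintegral_cst// mulrC.
by move=> y; rewrite inE => ->.
Qed.

Lemma average_weights (K : nat) (nu : nat -> prob_on Omega) nubar : (0 < K)%N ->
  is_average K nu nubar -> (forall k, nu k (range x) = 1%E) ->
  nubar (range x) = 1%E /\
  forall i, K%:R * weight nubar i = \sum_(0 <= k < K) weight (nu k) i.
Proof.
move=> K0 avg nux; have KR0 : K%:R != 0 :> R by rewrite pnatr_eq0 -lt0n.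
split=> [|i].
  rewrite avg; last exact: measurable_range.
  under eq_bigr do rewrite nux.
  by rewrite sumEFin -EFinM sumr_const_nat subn0 mulVf.
apply: EFin_inj; rewrite EFinM weightK avg; last exact: measurable_set1_rV.
rewrite muleA -EFinM divff// mul1e -sumEFin.
by apply: eq_bigr => k _; rewrite weightK.
Qed.

(** The infimum is positive because it is attained at one of the finitely many
    points. *)
Lemma min_mass_bounds mu : mu (range x) = 1%E -> (forall i, 0 < weight mu i) ->
  0 < min_mass mu (range x) /\ forall i, min_mass mu (range x) <= weight mu i.
Proof.
move=> mux mu0.
have [i0 _] := sum1_inhabited _ (sum_weights _ mux).
split=> [|i].
  have [i1 _ i1min] := @arg_minP _ _ 'I_n i0 xpredT (weight mu) isT.
  apply: lt_le_trans (mu0 i1) _; apply: lb_le_inf.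
    by exists (weight mu i0), (x i0) => //; exists i0.
  by move=> _ [_ [i _ <-] <-]; exact: i1min.
apply: inf_lbound; last by exists (x i) => //; exists i.
by exists 0 => _ [_ [j _ <-] <-]; exact: weight_ge0.
Qed.

Section MirrorProxOnOmega.
Variable J : prob_on Omega -> T -> R.
Hypotheses (J_continuous : continuous_valued J) (J_monotone : lasry_lions_monotone J).
Variable Lm : R.
Hypotheses (Lm_gt0 : 0 < Lm) (J_lipschitz : W1_lipschitz Lm J).

Lemma lipschitz_pointwise mu nu (c : R) y : (W1 mu nu <= c%:E)%E -> Omega y ->
  `|J mu y - J nu y| <= Lm * c.
Proof.
move=> W1c Oy; apply: (supnorm_le (fun z => J mu z - J nu z)) => //.
by rewrite (le_trans (J_lipschitz mu nu))// EFinM lee_wpmul2l// lee_fin ltW.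
Qed.

(** A strict upper bound in [\bar R], where [0^-1 = +oo], also covers the
    one-point domain [D = 0]. *)
Lemma stepsize_bound (lambda D : R) : 0 <= D ->
  (lambda%:E < (Lm * D)%:E^-1)%E -> lambda * (Lm * D) <= 1.
Proof.
move=> D0; have [->|D_neq0] := eqVneq D 0; first by move=> _; rewrite !mulr0.
have LD0 : 0 < Lm * D by rewrite mulr_gt0// lt_neqAle eq_sym D_neq0.
rewrite inver gt_eqF// lte_fin => /ltW.
by rewrite -ler_pdivlMr// div1r.
Qed.

(** The regret bound for the weights of [eta], after monotonicity has replaced
    the varying costs [J (nu k)] by the fixed cost [J eta]: only then does the
    sum over [k] become a pairing with the average [nubar]. *)
Lemma mirror_prox_minty_gap (lambda : R) (mu0 : prob_on Omega)
    (mu nu : nat -> prob_on Omega) (K : nat) (nubar eta : prob_on Omega) :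
  0 < lambda -> (lambda%:E < (Lm * diameter Omega)%:E^-1)%E ->
  mu0 (range x) = 1%E -> (forall i, (0 < mu0 [set x i])%E) ->
  mirror_prox J lambda mu0 mu nu -> (0 < K)%N -> is_average K nu nubar ->
  eta (range x) = 1%E ->
  lambda * (K%:R * pairing (J eta) nubar eta) <=
    ln (1 / min_mass mu0 (range x)).
Proof.
move=> lambda0 lambda_lt mu0x mu00 [muE mpE] K0 avg etax.
have w00 i : 0 < weight mu0 i by rewrite -lte_fin weightK.
have mux k : mu k (range x) = 1%E /\ forall i, 0 < weight (mu k) i.
  elim: k => [|k [mukx muk0]]; first by rewrite muE.
  have [gnu gmu] := mpE k.
  have [mukx' mukE] := gibbs_update_weights _ _ _ _ (J_continuous _) mukx muk0 gmu.
  split=> // i; rewrite mukE; apply: divr_gt0; first by rewrite mulr_gt0 ?expR_gt0.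
  by apply: gibbs_mass_gt0 => //; exact: sum_weights.
have numu k := gibbs_update_weights _ _ _ _ (J_continuous _) (mux k).1 (mux k).2 (mpE k).1.
have mumu k := gibbs_update_weights _ _ _ _ (J_continuous _) (mux k).1 (mux k).2 (mpE k).2.
have [m0 m_le] := min_mass_bounds _ mu0x w00.
have [nubarx nubarE] := average_weights _ _ _ K0 avg (fun k => (numu k).1).
have D0 : 0 <= diameter Omega.
  have [i0 _] := sum1_inhabited _ (sum_weights _ mu0x).
  by apply: (diameter_ge0 _ (x i0) Omega_compact); apply: x_Omega; exists i0.
have lambdac : lambda * (Lm * (diameter Omega * (1 / 2))) <= 1 / 2.
  by have := stepsize_bound _ _ D0 lambda_lt; lra.
have Jnumu k i : `|J (nu k) (x i) - J (mu k) (x i)| <=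
    Lm * (diameter Omega * (1 / 2)) * \sum_j `|weight (nu k) j - weight (mu k) j|.
  rewrite -2!mulrA; apply: lipschitz_pointwise; last by apply: x_Omega; exists i.
  under eq_bigr do rewrite distrC.
  by apply: W1_le_total_variation => //; [exact: (numu k).1|exact: (mux k).1].
have m_le0 i : min_mass mu0 (range x) <= weight (mu 0%N) i by rewrite muE m_le.
have := @mirror_prox_regret R n lambda _ _ (fun k => weight (mu k)) (fun k => weight (nu k))
  (fun k i => J (nu k) (x i)) (fun k i => J (mu k) (x i)) (weight eta) K
  lambda0 lambdac m0 _ _ _ _ _ Jnumu (fun i => weight_ge0 eta i) (sum_weights _ etax).
move=> /(_ m_le0 (fun k => (mux k).2) (fun k => sum_weights _ (mux k).1)
  (fun k => (numu k).2) (fun k => (mumu k).2)).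
apply: le_trans; rewrite ler_pM2l//.
rewrite (pairing_weights _ _ _ (J_continuous _) nubarx etax).
have -> : K%:R * \sum_i J eta (x i) * (weight nubar i - weight eta i) =
    \sum_(0 <= k < K) pairing (J eta) (nu k) eta.
  rewrite mulr_sumr.
  under [RHS]eq_bigr do rewrite (pairing_weights _ _ _ (J_continuous _) (numu _).1 etax).
  rewrite exchange_big/=; apply: eq_bigr => i _.
  rewrite -mulr_sumr mulrCA mulrBr nubarE sumrB sumr_const_nat subn0.
  by rewrite mulr_natl.
apply: ler_sum => k _.
rewrite -(pairing_weights _ _ _ (J_continuous (nu k)) (numu k).1 etax).
have := J_monotone (nu k) eta; rewrite /pairing.
have int (zeta : prob_on Omega) f : {within Omega, continuous f} ->
  zeta.-integrable Omega (EFin \o f) by exact: integrable_within_compact.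
by rewrite !RintegralB//; try exact: int; lra.
Qed.

End MirrorProxOnOmega.
End FiniteSupportOnOmega.
End CompactDomain.

(** * Limit points of the averaged iterates *)

(* The bound on lambda is taken in \bar R, where 0^-1 = +oo, so that it is no
   restriction when Omega is a single point.  Families (.)_{h > 0} are functions
   of h : R on which nothing is assumed for h <= 0. *)
Theorem theorem3p1 (R : realType) (d : nat) (Omega : set 'rV[R]_d)
  (Omega_nonempty : Omega !=set0) (Omega_compact : compact Omega)
  (J : prob_on Omega -> 'rV[R]_d -> R)
  (J_continuous : continuous_valued J)
  (J_monotone : lasry_lions_monotone J)
  (Lm : R) (Lm_gt0 : 0 < Lm) (J_lipschitz : W1_lipschitz Lm J)
  (X : R -> set 'rV[R]_d)
  (X_finite : forall h : R, 0 < h -> finite_set (X h))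
  (X_sub : forall h : R, 0 < h -> X h `<=` Omega)
  (Q : R -> 'rV[R]_d -> 'rV[R]_d)
  (Q_measurable : forall h : R, 0 < h -> measurable_fun Omega (Q h))
  (Q_range : forall h : R, 0 < h -> forall x, Omega x -> X h (Q h x))
  (Q_approx : forall h : R, 0 < h ->
     (supnorm Omega (fun x => eucl_dist (Q h x) x) <= h%:E)%E)
  (mu0 : R -> prob_on Omega)
  (mu0_supported : forall h : R, 0 < h -> mu0 h (X h) = 1%E)
  (mu0_full : forall h : R, 0 < h ->
     forall x, X h x -> (0 < mu0 h [set x])%E)
  (lambda : R) (lambda_gt0 : 0 < lambda)
  (lambda_lt : (lambda%:E < (Lm * diameter Omega)%:E^-1)%E)
  (mu nu : R -> nat -> prob_on Omega)
  (iterates : forall h : R, 0 < h ->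
     mirror_prox J lambda (mu0 h) (mu h) (nu h))
  (K : R -> nat) (K_gt0 : forall h : R, 0 < h -> (0 < K h)%N)
  (K_cvg : K h @[h --> 0^'+] --> \oo)
  (K_rate : ln (1 / min_mass (mu0 h) (X h)) / (K h)%:R @[h --> 0^'+] --> 0)
  (nubar : R -> prob_on Omega)
  (nubar_average : forall h : R, 0 < h ->
     is_average (K h) (nu h) (nubar h))
  (hseq : nat -> R) (hseq_gt0 : forall j, 0 < hseq j)
  (hseq_cvg : hseq j @[j --> \oo] --> 0)
  (nubar_lim : prob_on Omega)
  (nubar_cvg : weak_cvg (fun j => nubar (hseq j)) nubar_lim) :
  minty_solution J nubar_lim.
Proof.
move=> eta.
pose h j := hseq j.
have h_gt0 j : 0 < h j by exact: hseq_gt0.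
have QO j y : Omega y -> Omega (Q (h j) y) by move=> Oy; exact/X_sub/Q_range.
have Qh j y : Omega y -> eucl_dist (Q (h j) y) y <= h j.
  move=> Oy; have := supnorm_le _ _ _ (Q_approx _ (h_gt0 j)) Oy.
  by rewrite ger0_norm// eucl_dist_ge0.
have gap j : \int[nubar (h j)]_(y in Omega) J eta y
    - \int[eta]_(y in Omega) J eta (Q (h j) y) <=
    lambda^-1 * (ln (1 / min_mass (mu0 (h j)) (X (h j))) / (K (h j))%:R)
    + 2 * Lm * h j.
  have [n [x [x_inj xX]]] := finite_set_enumeration _ _ (X_finite _ (h_gt0 j)).
  have mX : measurable (X (h j)) by rewrite -xX; exact: measurable_range.
  have x_Omega : range x `<=` Omega by rewrite xX; exact: X_sub.
  have [etah [etahX W1etah intetah]] := quantization Omega_compact eta _ _ _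
    (ltW (h_gt0 j)) mX (X_sub _ (h_gt0 j)) (Q_measurable _ (h_gt0 j))
    (Q_range _ (h_gt0 j)) (Qh j).
  rewrite -intetah//.
  have := @mirror_prox_minty_gap R d Omega Omega_compact n x x_inj x_Omega J
    J_continuous J_monotone Lm Lm_gt0 J_lipschitz lambda _ _ _ _ _ etah
    lambda_gt0 lambda_lt _ _ (iterates _ (h_gt0 j)) (K_gt0 _ (h_gt0 j))
    (nubar_average _ (h_gt0 j)).
  rewrite xX => /(_ (mu0_supported _ (h_gt0 j)) _ etahX) gap_etah.
  have {}gap_etah : pairing (J etah) (nubar (h j)) etah <=
      lambda^-1 * (ln (1 / min_mass (mu0 (h j)) (X (h j))) / (K (h j))%:R).
    rewrite mulrC ler_pdivlMr// ler_pdivlMr ?ltr0n ?K_gt0//.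
    rewrite -mulrA mulrC -mulrA gap_etah// => i.
    by apply: mu0_full => //; rewrite -xX; exists i.
  apply: le_trans (pairing_le_sup Omega_compact _ _ (J eta) (J etah) (Lm * h j) _ _ _) _ => //.
    move=> y Oy; rewrite distrC.
    exact: (lipschitz_pointwise J Lm Lm_gt0 J_lipschitz).
  by rewrite mulrA lerD2r.
have cvg_h_right (u : R -> R) (l : R) : u t @[t --> 0^'+] --> l ->
  u (h j) @[j --> \oo] --> l.
  by move=> /cvg_at_rightP; apply; split.
have gap_cvg : \int[nubar (h j)]_(y in Omega) J eta y
    - \int[eta]_(y in Omega) J eta (Q (h j) y) @[j --> \oo] -->
    \int[nubar_lim]_(y in Omega) J eta y - \int[eta]_(y in Omega) J eta y.
  apply: cvgB; first exact: nubar_cvg.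
  apply: (cvg_integral_quantized Omega_compact eta (fun j => Q (h j)) h) => //.
  by move=> j; exact: Q_measurable.
have rate_cvg : lambda^-1 * (ln (1 / min_mass (mu0 (h j)) (X (h j))) / (K (h j))%:R)
    + 2 * Lm * h j @[j --> \oo] --> lambda^-1 * 0 + 2 * Lm * 0.
  apply: cvgD; apply: cvgM => //; try exact: cvg_cst.
  exact: cvg_h_right K_rate.
rewrite !mulr0 addr0 in rate_cvg.
rewrite /pairing.
by apply: ler_cvg_to gap_cvg rate_cvg _; near=> j; exact: gap.
Unshelve. all: by end_near.
Qed.
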